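(* The task assignment $q_n^*$ defined in the context is an optimizer of the problem of maximizing $$u(q)=\sum_{i=1}^m\sum_{j=0}^\infty u_i(j)\left[q(i,j)-q(i,j+1)\right]$$ over all $q\in\mathbb{R}^{\mathcal{I}}$ subject to the constraints $$\sum_{i=1}^m\sum_{j=1}^\infty q(i,j)=\rho\quad\text{and}\quad 0\leq q(i,j+1)\leq q(i,j)\leq q(i,0)=\alpha_n(i)\ \text{ for all }(i,j)\in\mathcal{I}.$$
   Context: Let $\mathbb{N}=\{0,1,2,\dots\}$, $m\geq 1$ and $\rho>0$. For $i=1,\dots,m$ let $u_i:[0,\infty)\to\mathbb{R}$ be a concave function (only its values on $\mathbb{N}$ matter) and $\Delta(i,j)=u_i(j+1)-u_i(j)$ for $j\in\mathbb{N}$. Let $\alpha_n(i)>0$, $i=1,\dots,m$, with $\sum_i\alpha_n(i)=1$ (the fractions of server pools of each class in a system with $n$ server pools). Let $\mathcal{I}=\{1,\dots,m\}\times\mathbb{N}$ and $\mathcal{I}_+=\{(i,j)\in\mathcal{I}:j\geq 1\}$. Define a total order $\vartriangleleft$ on $\mathcal{I}_+$ by: $(i,j)\vartriangleleft(i',j')$ iff either $\Delta(i,j-1)<\Delta(i',j'-1)$, or $\Delta(i,j-1)=\Delta(i',j'-1)$ and $(i,j)$ is strictly larger than $(i',j')$ in the lexicographic order ($i>i'$, or $i=i'$ and $j>j'$). Write $\vartriangleright$ for the reverse order and $\trianglerighteq$ for its non-strict version. Let $\sigma_n^*$ be the unique element of $\mathcal{I}_+$ such that $\sum_{(i,j)\vartriangleright\sigma_n^*}\alpha_n(i)\leq\rho<\sum_{(i,j)\trianglerighteq\sigma_n^*}\alpha_n(i)$.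 Define $q_n^*(i,0)=\alpha_n(i)$ for all $i$ and, for $(i,j)\in\mathcal{I}_+$, $q_n^*(i,j)=0$ if $(i,j)\vartriangleleft\sigma_n^*$, $q_n^*(i,j)=\alpha_n(i)$ if $(i,j)\vartriangleright\sigma_n^*$, and $q_n^*(\sigma_n^* )=\rho-\sum_{(i,j)\vartriangleright\sigma_n^*}\alpha_n(i)$. For feasible $q$ the series $u(q)$ is well defined in $[-\infty,\infty)$. *)

(* Defs.v *)
From HB Require Import structures.
From mathcomp Require Export all_boot all_order all_algebra.
From mathcomp Require Export all_classical all_reals all_analysis.

Set Implicit Arguments.
Unset Strict Implicit.
Unset Printing Implicit Defensive.

Import Order.TTheory GRing.Theory Num.Theory.
Import numFieldNormedType.Exports.

Local Open Scope classical_set_scope.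
Local Open Scope ring_scope.

(* (i, j) : server pools of class i, position j; the classes 1, ..., m are
   numbered 0, ..., m - 1, which preserves the lexicographic order. *)
Definition slot (m : nat) : Type := ('I_m * nat)%type.
Definition slot_pos (m : nat) : set (slot m) := [set p | (0 < p.2)%N].

(* Utilities are total functions on R; only [0, +oo[ is constrained. *)
Definition concave_on_nonneg (R : realType) (v : R -> R) : Prop :=
  convex_function (`[0, +oo[%classic : set R) (fun x : R => - v x).

Definition marginal (R : realType) (m : nat) (u : 'I_m -> R -> R)
    (i : 'I_m) (j : nat) : R :=
  u i j.+1%:R - u i j%:R.

(* [slot_lt u p p'] is p ◁ p'; it is meant for slots with positive second
   component (the predecessor truncates at 0).  Ties are broken by the
   reversed lexicographic order. *)
Definition slot_lt (R : realType) (m : nat) (u : 'I_m -> R -> R)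
    (p p' : slot m) : bool :=
  let d (r : slot m) := marginal u r.1 r.2.-1 in
  (d p < d p') ||
  ((d p == d p') && ((p'.1 < p.1)%N || ((p'.1 == p.1) && (p'.2 < p.2)%N))).

Section Assignment.
Variables (R : realType) (m : nat) (u : 'I_m -> R -> R).
Variables (alpha : 'I_m -> R) (rho : R).

Definition mass_gt (s : slot m) : \bar R :=
  (\esum_(p in [set p | slot_pos p /\ slot_lt u s p]) (alpha p.1)%:E)%E.

Definition mass_ge (s : slot m) : \bar R :=
  (\esum_(p in [set p | slot_pos p /\ (p = s \/ slot_lt u s p)])
     (alpha p.1)%:E)%E.

Definition is_threshold (s : slot m) : Prop :=
  slot_pos s /\ (mass_gt s <= rho%:E < mass_ge s)%E.

(* [mass_gt s] is finite when [s] is the threshold, so [fine] loses nothing. *)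
Definition q_star (s : slot m) (p : slot m) : R :=
  if p.2 == 0%N then alpha p.1
  else if p == s then rho - fine (mass_gt s)
  else if slot_lt u s p then alpha p.1
  else 0.

Definition feasible (q : slot m -> R) : Prop :=
  (\sum_(i < m) \sum_(1 <= j <oo) (q (i, j))%:E = rho%:E)%E /\
  forall (i : 'I_m) (j : nat),
    [/\ 0 <= q (i, j.+1), q (i, j.+1) <= q (i, j), q (i, j) <= q (i, 0%N)
      & q (i, 0%N) = alpha i].

(* For feasible q each inner series converges in [-oo, +oo[: u_i grows at most
   linearly and has constant sign from some point on. *)
Definition utility (q : slot m -> R) : \bar R :=
  (\sum_(i < m) \sum_(0 <= j <oo)
     (u i j%:R * (q (i, j) - q (i, j.+1)))%:E)%E.

Definition is_optimizer (q : slot m -> R) : Prop :=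
  feasible q /\ forall q' : slot m -> R, feasible q' ->
    (utility q' <= utility q)%E.

End Assignment.

(* Main.v *)
Require Import Defs.
From mathcomp Require Import all_boot all_order all_algebra.
From mathcomp Require Import all_classical all_reals all_analysis.
From mathcomp Require Import ring lra.

(* Lagrangian duality. Let [lam] be the marginal utility of the threshold slot
   and [w i j := u i j - lam * j]. Since the constraint fixes the total mass
   [rho], Abel summation turns the utility of a feasible [q] into
     [lam * rho + \sum_i \sum_j w i j * (q (i, j) - q (i, j.+1))].
   The inner sums are averages of [w i] of weight [alpha i], hence at most
   [alpha i * M i] with [M i := max_j w i j]. By concavity this maximum is
   attained at the number [k] of slots of class [i] above the threshold, and
   also at [k.+1] when the threshold lies in class [i]; these are the only [j]
   at which [q_star (i, j) - q_star (i, j.+1)] is nonzero, so [q_star] attains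
   the bound. *)

Set Implicit Arguments.
Unset Strict Implicit.
Unset Printing Implicit Defensive.

Import Order.TTheory GRing.Theory Num.Theory.
Import numFieldNormedType.Exports.
Local Open Scope classical_set_scope.
Local Open Scope ring_scope.

(** * Abel summation for nonincreasing summable sequences *)

Lemma nneseries_EFin_cvg (R : realType) (f : nat -> R) (k : nat) (S : R) :
  (forall j, 0 <= f j) -> (\sum_(k <= j <oo) (f j)%:E = S%:E)%E ->
  \sum_(k <= j < n) f j @[n --> \oo] --> S.
Proof.
move=> f0 fS.
have : (\sum_(k <= j < n) (f j)%:E)%E @[n --> \oo] --> S%:E.
  by rewrite -fS; apply: is_cvg_nneseries => n _ _; rewrite lee_fin.
move/fine_cvg; apply: cvg_trans; apply: near_eq_cvg; apply: nearW => n /=.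
by rewrite sumEFin.
Qed.

Lemma sum_index_diff (R : realType) (q : nat -> R) (n : nat) :
  \sum_(0 <= j < n.+1) j%:R * (q j - q j.+1) =
  \sum_(1 <= j < n.+1) q j - n%:R * q n.+1.
Proof.
elim: n => [|n IHn]; first by rewrite big_nat1 big_geq// !mul0r subr0.
by rewrite big_nat_recr//= IHn [in RHS]big_nat_recr//= -natr1; ring.
Qed.

Section NonincreasingSeries.
Variables (R : realType) (q : nat -> R) (S : R).
Hypothesis q_ge0 : forall j, 0 <= q j.
Hypothesis q_noninc : forall j, q j.+1 <= q j.
Hypothesis q_sum : (\sum_(1 <= j <oo) (q j)%:E = S%:E)%E.

Let tail_sum_cvg : \sum_(1 <= j < n.+1) q j @[n --> \oo] --> S.
Proof.
rewrite (cvg_shiftS (fun n => \sum_(1 <= j < n) q j)).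
exact: nneseries_EFin_cvg.
Qed.

Lemma nonincreasing_summable_cvg0 : q n @[n --> \oo] --> 0.
Proof.
rewrite -cvg_shiftS; apply: cvg_series_cvg_0; apply/cvg_ex; exists S.
have -> : series (fun n => q n.+1) = (fun n => \sum_(1 <= j < n.+1) q j).
  by apply/funext => n; rewrite big_add1.
exact: tail_sum_cvg.
Qed.

(* Summation by parts leaves the boundary term [n * q n.+1], which vanishes
   because it is dominated by the tail of the convergent series of
   [j * (q j - q j.+1)]. *)
Lemma index_diff_cvg :
  \sum_(0 <= j < n) j%:R * (q j - q j.+1) @[n --> \oo] --> S.
Proof.
rewrite -cvg_shiftS /=.
pose P n := \sum_(0 <= j < n.+1) j%:R * (q j - q j.+1).
have ndP : nondecreasing_seq P.
  apply/nondecreasing_seqP => n; rewrite /P [leRHS]big_nat_recr//= lerDl.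
  by rewrite mulr_ge0// subr_ge0.
have ndA : nondecreasing_seq (fun n => \sum_(1 <= j < n.+1) q j).
  by apply/nondecreasing_seqP => n; rewrite [leRHS]big_nat_recr//= lerDl.
have PleS n : P n <= S.
  rewrite /P sum_index_diff; apply: (@le_trans _ _ (\sum_(1 <= j < n.+1) q j)).
    by rewrite gerBl mulr_ge0.
  rewrite -(cvg_lim (@Rhausdorff R) tail_sum_cvg).
  by apply: (nondecreasing_cvgn_le ndA); apply/cvg_ex; exists S.
have cvgP : cvgn P.
  by apply: nondecreasing_is_cvgn => //; exists S => _ [n _ <-].
have bnd n : n%:R * q n.+1 <= limn P - P n.
  (* Each increment of [P] past [n] has weight at least [n], so it dominates [n] times a telescoping
     difference; letting [m] grow removes [q (n + m).+1]. *)
  have step m : n%:R * q n.+1 <= P (n + m)%N + n%:R * q (n + m).+1 - P n.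
    elim: m => [|m IHm]; first by rewrite addn0; lra.
    apply: (le_trans IHm); rewrite addnS [P (n + m).+1]/P big_nat_recr//= -/(P _).
    have := q_noninc (n + m).+1; rewrite -subr_ge0 => d0.
    have : 0 <= (m.+1)%:R * (q (n + m).+1 - q (n + m).+2) by rewrite mulr_ge0.
    have -> : (n + m).+1%:R = n%:R + m.+1%:R :> R by rewrite -addnS natrD.
    lra.
  have lim : (P (n + m)%N + n%:R * q (n + m).+1 - P n) @[m --> \oo] -->
             limn P + n%:R * 0 - P n.
    apply: cvgB; last exact: cvg_cst.
    apply: cvgD.
      under eq_fun do rewrite addnC.
      by have : P @ \oo --> limn P := cvgP; rewrite -(cvg_shiftn n).
    apply: cvgMr.
    under eq_fun do rewrite -addnS addnC addSnnS.
    by have := nonincreasing_summable_cvg0; rewrite -(cvg_shiftn n.+1).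
  have -> : limn P - P n = limn P + n%:R * 0 - P n by rewrite mulr0 addr0.
  rewrite -(cvg_lim (@Rhausdorff R) lim); apply: limr_ge.
    by apply/cvg_ex; eexists; exact: lim.
  exact: nearW.
have nq0 : n%:R * q n.+1 @[n --> \oo] --> 0.
  apply: (@squeeze_cvgr _ _ _ _ (fun=> 0) (fun n => limn P - P n)).
  - by apply: nearW => n; rewrite bnd mulr_ge0.
  - exact: cvg_cst.
  - by rewrite -[X in _ --> X](subrr (limn P)); apply: cvgB => //; exact: cvg_cst.
rewrite -[S]subr0.
under eq_fun do rewrite sum_index_diff.
exact: cvgB.
Qed.

(** The constant [M] telescopes to [M * q 0] and the linear part sums to [lam * S]. The gap terms
    are nonnegative, so their series converges, possibly to [+oo]; subtracting it from a real number
    is never indeterminate. *)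
Lemma abel_lagrangian (v : nat -> R) (lam M : R) :
  (forall j, v j - lam * j%:R <= M) ->
  (\sum_(0 <= j <oo) (v j * (q j - q j.+1))%:E =
   (M * q 0%N + lam * S)%:E -
   \sum_(0 <= j <oo) ((M - (v j - lam * j%:R)) * (q j - q j.+1))%:E)%E.
Proof.
move=> vM; apply: cvg_lim => //.
have gap_ge0 j : 0 <= (M - (v j - lam * j%:R)) * (q j - q j.+1).
  by rewrite mulr_ge0 ?subr_ge0.
have key n : \sum_(0 <= j < n) v j * (q j - q j.+1) =
   (M * (q 0%N - q n) + lam * \sum_(0 <= j < n) j%:R * (q j - q j.+1)) -
   \sum_(0 <= j < n) (M - (v j - lam * j%:R)) * (q j - q j.+1).
  elim: n => [|n IHn]; first by rewrite !big_geq//; ring.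
  by rewrite !big_nat_recr//= IHn; ring.
under eq_fun do rewrite sumEFin key EFinB.
apply: cvgeB.
- by rewrite fin_num_adde_defr.
- apply: cvg_EFin; first by apply: nearW.
  apply: cvgD; apply: cvgMr; last exact: index_diff_cvg.
  rewrite -[X in _ --> X]subr0; apply: cvgB; first exact: cvg_cst.
  exact: nonincreasing_summable_cvg0.
- under eq_fun do rewrite -sumEFin.
  by apply: is_cvg_nneseries => n _ _; rewrite lee_fin.
Qed.

End NonincreasingSeries.

(** * Discrete concavity and sums over slots *)

Lemma concave_marginal_le (R : realType) (v : R -> R) (j : nat) :
  concave_on_nonneg v ->
  v j.+2%:R - v j.+1%:R <= v j.+1%:R - v j%:R.
Proof.
have half_ge0 : 0 <= (2^-1 : R) by lra.
have half_le1 : (2^-1 : R) <= 1 by lra.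
have H (k : nat) : (k%:R : R) \in (`[0, +oo[%classic : set R).
  by rewrite inE /= in_itv/= andbT ler0n.
(* Weight 1/2 makes [j.+1] the midpoint of [j] and [j.+2]. *)
pose t : {i01 R} := Itv01 half_ge0 half_le1.
move=> /(_ t j%:R j.+2%:R (H j) (H j.+2)).
rewrite [X in v X](_ : _ = 2^-1 * j%:R + (1 - 2^-1) * j.+2%:R) //.
rewrite (_ : 2^-1 * j%:R + _ = j.+1%:R); last by rewrite -!natr1; field.
rewrite convRE /= /unstable.onem.
lra.
Qed.

(** Links the iterated series in [feasible] to the unordered sums in [mass_gt]; for nonnegative
    terms the order of summation is irrelevant. *)
Lemma slot_sum_esum (R : realType) (m : nat) (f : slot m -> \bar R) :
  (forall p, slot_pos p -> (0 <= f p)%E) ->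
  (\sum_(i < m) \sum_(1 <= j <oo) f (i, j) = \esum_(p in @slot_pos m) f p)%E.
Proof.
move=> f0.
have inner i : (\sum_(1 <= j <oo) f (i, j) =
    \esum_(j in [set j | (0 < j)%N]) f (i, j))%E.
  rewrite -[RHS](@nneseries_esum _ _ (fun j => (0 < j)%N)); last first.
    by move=> j j0; exact: (f0 (i, j)).
  rewrite [RHS]eseries_mkcond nneseries_recl//=.
    rewrite add0e; apply: congr_lim; apply/funext => n /=.
    by apply: eq_big_nat => j /andP[j1 _]; rewrite j1.
  by move=> j _; case: ifP => // /(f0 (i, j)).
under eq_bigr do rewrite inner.
rewrite (_ : (\sum_(i < m) _ = \esum_(i in [set: 'I_m])
    \esum_(j in [set j | (0 < j)%N]) f (i, j))%E); last first.
  rewrite esum_fset; [|exact: finite_finset|]; last first.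
    by move=> i _; apply: esum_ge0 => j; exact: (f0 (i, j)).
  rewrite -big_enum fsbig_seq ?enum_uniq//; apply: eq_fsbigl.
  by apply/seteqP; split => i //= _; rewrite mem_enum.
have jf0 (i : 'I_m) (j : nat) : [set: 'I_m] i -> (0 < j)%N -> (0 <= f (i, j))%E.
  by move=> _; exact: (f0 (i, j)).
rewrite (_ : @slot_pos m = [set: 'I_m] `*`` (fun=> [set j | (0 < j)%N])).
  apply: etrans (esum_esum jf0) _.
  by apply: eq_esum => -[].
by apply/seteqP; split => -[i j] //= [].
Qed.

(** * Lagrangian form of the utility of a feasible assignment *)

Section Feasible.
Variables (R : realType) (m : nat) (u : 'I_m -> R -> R) (alpha : 'I_m -> R).
Variables (rho : R) (q : slot m -> R).
Hypothesis q_feasible : feasible alpha rho q.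

Lemma feasible_ge0 (p : slot m) : 0 <= q p.
Proof.
case: p => i [|j]; last by case: (q_feasible.2 i j).
by case: (q_feasible.2 i 0%N) => q1 q10 _ _; exact: le_trans q1 q10.
Qed.

(** A finite total forces every class total to be finite, so [rho] splits into real class totals. *)
Lemma feasible_class_sums : exists2 S : 'I_m -> R, \sum_(i < m) S i = rho &
  forall i, (\sum_(1 <= j <oo) (q (i, j))%:E = (S i)%:E)%E.
Proof.
pose T i := (\sum_(1 <= j <oo) (q (i, j))%:E)%E.
have T_fin i : T i \is a fin_num.
  have : (\sum_(i < m) T i)%E \is a fin_num by rewrite /T q_feasible.1.
  by move/sum_fin_numP => /(_ i); apply; rewrite ?mem_index_enum.
exists (fun i => fine (T i)); last by move=> i; rewrite fineK.
apply/EFin_inj; rewrite -q_feasible.1 -sumEFin.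
by apply: eq_bigr => i _; rewrite fineK.
Qed.

(** The class totals add up to [rho], so [q] only enters through the nonnegative gap sums; their
    signs also allow negation to pass through the sum over classes. *)
Lemma feasible_utility (lam : R) (M : 'I_m -> R) :
  (forall i j, u i j%:R - lam * j%:R <= M i) ->
  (utility u q = (\sum_(i < m) M i * alpha i + lam * rho)%:E -
   \sum_(i < m) \sum_(0 <= j <oo)
     ((M i - (u i j%:R - lam * j%:R)) * (q (i, j) - q (i, j.+1)))%:E)%E.
Proof.
move=> uM; have [S <- qS] := feasible_class_sums.
have noninc i j : q (i, j.+1) <= q (i, j) by case: (q_feasible.2 i j).
have q0 i : q (i, 0%N) = alpha i by case: (q_feasible.2 i 0%N).
rewrite mulr_sumr -big_split /= -sumEFin -sumeN; last first.
  move=> i k _ _; apply: ge0_adde_def; rewrite inE; apply: nneseries_ge0 => j _ _.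
    by rewrite lee_fin mulr_ge0 // subr_ge0.
  by rewrite lee_fin mulr_ge0 // subr_ge0.
rewrite -big_split /=; apply: eq_bigr => i _.
rewrite (abel_lagrangian (q := fun j => q (i, j)) _ _ (qS i) (uM i)) ?q0//.
by move=> j; exact: feasible_ge0.
Qed.

End Feasible.

(** * The order on slots *)

Section Threshold.
Variables (R : realType) (m : nat) (u : 'I_m -> R -> R).
Hypothesis u_concave : forall i, concave_on_nonneg (u i).

Lemma slot_lt_irr (p : slot m) : slot_lt u p p = false.
Proof. by rewrite /slot_lt !ltxx !ltnn /= andbF andbF. Qed.

Lemma slot_lt_marginal (p p' : slot m) : slot_lt u p p' ->
  marginal u p.1 p.2.-1 <= marginal u p'.1 p'.2.-1.
Proof. by move=> /orP[/ltW//|/andP[/eqP-> _]]. Qed.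

Lemma slot_nlt_marginal (p p' : slot m) : ~~ slot_lt u p p' ->
  marginal u p'.1 p'.2.-1 <= marginal u p.1 p.2.-1.
Proof. by rewrite negb_or -leNgt => /andP[]. Qed.

Lemma slot_lt_trans : transitive (slot_lt u).
Proof.
move=> [b b2] [a a2] [c c2]; rewrite /slot_lt /=.
move: (marginal u a _) (marginal u b _) (marginal u c _) => x y z.
case/orP => [xy|/andP[/eqP-> h1]]; case/orP => [yz|/andP[/eqP<- h2]].
- by rewrite (lt_trans xy yz).
- by rewrite xy.
- by rewrite yz.
- rewrite eqxx ltxx /=.
  case/orP: h1 => [h1|/andP[/eqP h1 h1']]; case/orP: h2 => [h2|/andP[/eqP h2 h2']].
  + by rewrite (ltn_trans h2 h1).
  + by rewrite h2 h1.
  + by rewrite -h1 h2.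
  + by rewrite -h1 h2 eqxx (ltn_trans h2' h1') orbT.
Qed.

(** Concavity makes marginals nonincreasing in [j], and the tie-break favours the smaller [j], which
    makes the comparison strict. *)
Lemma slot_lt_column (i : 'I_m) (j j' : nat) : (j < j')%N ->
  slot_lt u (i, j'.+1) (i, j.+1).
Proof.
have step l : slot_lt u (i, l.+2) (i, l.+1).
  rewrite /slot_lt /= eqxx ltnSn orbT andbT orbC -le_eqVlt.
  exact: concave_marginal_le.
elim: j' => // j' IHj'; rewrite ltnS leq_eqVlt => /orP[/eqP->//|/IHj'].
exact: slot_lt_trans.
Qed.

(** * Feasibility of the threshold assignment *)

Variables (alpha : 'I_m -> R) (rho : R) (sigma : slot m).
Hypothesis alpha_gt0 : forall i, 0 < alpha i.
Hypothesis sigma_threshold : is_threshold u alpha rho sigma.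

Let qs := q_star u alpha rho sigma.

Let esum_pos_delta (s : slot m) (c : R) : slot_pos s -> 0 <= c ->
  (\esum_(p in @slot_pos m) (if p == s then c else 0)%:E = c%:E)%E.
Proof.
move=> s_pos c0; rewrite -[RHS](@esum_set1 _ _ s (fun=> c%:E))//.
rewrite -[in RHS](setIidr (A := @slot_pos m) (B := [set s])); last by move=> _ ->.
rewrite esum_mkcondr; apply: eq_esum => p _.
rewrite (_ : (p \in [set s]) = (p == s)); first by case: ifP.
by apply/idP/eqP; rewrite inE.
Qed.

Let mass_gtE : (mass_gt u alpha sigma =
  \esum_(p in @slot_pos m) (if slot_lt u sigma p then alpha p.1 else 0)%:E)%E.
Proof.
rewrite /mass_gt (esum_mkcondr (@slot_pos m) [set p | slot_lt u sigma p]).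
apply: eq_esum => p _.
rewrite (_ : (p \in [set p | _]) = slot_lt u sigma p); first by case: ifP.
by apply/idP/idP; rewrite inE.
Qed.

Let mass_geE :
  (mass_ge u alpha sigma = mass_gt u alpha sigma + (alpha sigma.1)%:E)%E.
Proof.
case: sigma_threshold => sigma_pos _.
rewrite mass_gtE -(esum_pos_delta sigma_pos (ltW (alpha_gt0 _))) -esumD; first last.
- by move=> p _; case: ifP => _; rewrite lee_fin// ltW.
- by move=> p _; case: ifP => _; rewrite lee_fin// ltW.
rewrite /mass_ge (esum_mkcondr (@slot_pos m) [set p | p = sigma \/ slot_lt u sigma p]).
apply: eq_esum => p _.
rewrite (_ : (p \in [set p | _]) = (p == sigma) || slot_lt u sigma p); last first.
  by apply/idP/orP; rewrite inE => -[/eqP|]; [left|right|left|right].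
case: eqP => [->|_] /=; first by rewrite slot_lt_irr add0e.
by rewrite adde0; case: ifP.
Qed.

Let mass_gt_fine : mass_gt u alpha sigma = (fine (mass_gt u alpha sigma))%:E.
Proof.
case: sigma_threshold => _ /andP[le_rho _]; rewrite fineK//.
have mass_ge0 : (0 <= mass_gt u alpha sigma)%E.
  by apply: esum_ge0 => p _; rewrite lee_fin ltW.
by rewrite ge0_fin_numE//; exact: le_lt_trans le_rho (ltry _).
Qed.

(** These bounds are the two threshold inequalities, as [mass_ge] exceeds [mass_gt] by the mass of
    [sigma] itself. *)
Let q_star_sigma : 0 <= rho - fine (mass_gt u alpha sigma) <= alpha sigma.1.
Proof.
case: sigma_threshold => _; rewrite mass_geE mass_gt_fine -EFinD lee_fin lte_fin /=.
by move=> /andP[]; lra.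
Qed.

Let q_starE (i : 'I_m) (j : nat) : qs (i, j.+1) =
  if (i, j.+1) == sigma then rho - fine (mass_gt u alpha sigma)
  else if slot_lt u sigma (i, j.+1) then alpha i else 0.
Proof. by []. Qed.

Let q_star_above (i : 'I_m) (j : nat) : slot_lt u sigma (i, j.+1) ->
  qs (i, j.+1) = alpha i.
Proof.
move=> lt_j; rewrite q_starE lt_j ifN//.
by apply: contraTneq lt_j => ->; rewrite slot_lt_irr.
Qed.

Let q_star_ge0 (p : slot m) : 0 <= qs p.
Proof.
case: p => i [|j]; first exact: ltW (alpha_gt0 i).
rewrite q_starE; case: ifP => _; first by case/andP: q_star_sigma.
by case: ifP => // _; exact: ltW.
Qed.

Let q_star_le_alpha (p : slot m) : qs p <= alpha p.1.
Proof.
case: p => i [|j]; first exact: lexx.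
rewrite q_starE; case: eqP => [->|_]; first by case/andP: q_star_sigma.
by case: ifP => // _; exact: ltW.
Qed.

Let q_star_noninc (i : 'I_m) (j : nat) : qs (i, j.+1) <= qs (i, j).
Proof.
case: j => [|j]; first exact: q_star_le_alpha.
have [lt_j1|nlt_j1] := boolP (slot_lt u sigma (i, j.+1)).
  by rewrite [leRHS]q_star_above//; exact: q_star_le_alpha.
rewrite [leLHS]q_starE; case: eqP => [eq_sigma|_].
  (* If [sigma] is the next slot of the class, the current one lies above it. *)
  by rewrite -eq_sigma slot_lt_column in nlt_j1.
case: ifP => [lt_j2|_]; last exact: q_star_ge0.
by rewrite (slot_lt_trans lt_j2 (slot_lt_column i (ltnSn j))) in nlt_j1.
Qed.

Lemma q_star_feasible : feasible alpha rho qs.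
Proof.
case: (sigma_threshold) => sigma_pos _; have /andP[qsig0 qsig1] := q_star_sigma.
split; last first.
  move=> i j; split; [exact: q_star_ge0|exact: q_star_noninc| |by []].
  exact: q_star_le_alpha.
rewrite (slot_sum_esum (f := fun p => (qs p)%:E)); last first.
  by move=> p _; rewrite lee_fin.
transitivity (mass_gt u alpha sigma + (rho - fine (mass_gt u alpha sigma))%:E)%E.
  rewrite {1}mass_gtE -(esum_pos_delta sigma_pos qsig0) -esumD; first last.
  - by move=> p _; case: ifP => _; rewrite lee_fin.
  - by move=> p _; case: ifP => _; rewrite lee_fin// ltW.
  apply: eq_esum => -[i [|j]] // _; rewrite q_starE -EFinD.
  case: eqP => [->|_]; first by rewrite slot_lt_irr add0r.
  by rewrite addr0.
by rewrite mass_gt_fine -EFinD addrC subrK.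
Qed.

(** * Complementary slackness *)

Let q_star_summable (i : 'I_m) : exists S : R,
  (\sum_(1 <= j <oo) (qs (i, j))%:E = S%:E)%E.
Proof. by have [S _ Sq] := feasible_class_sums q_star_feasible; exists (S i). Qed.

(** Along a class [qs] tends to 0 but equals [alpha i > 0] above [sigma], so some slot is not above;
    [k] is the least such index, and by the column order everything after it is not above either.
    Index [j] stands for slot [j.+1], so [k] counts the slots above. *)
Let level (i : 'I_m) : exists k : nat,
  (forall j, (j < k)%N -> slot_lt u sigma (i, j.+1)) /\
  (forall j, (k <= j)%N -> ~~ slot_lt u sigma (i, j.+1)).
Proof.
have [S qS] := q_star_summable i.
have q0 : qs (i, j) @[j --> \oo] --> 0.
  exact: (nonincreasing_summable_cvg0 (q := fun j => qs (i, j))) qS.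
have ex_k : exists k, ~~ slot_lt u sigma (i, k.+1).
  have [k _ /(_ k.+1 (leqnSn k)) lt_alpha] := cvgr_lt _ q0 _ (alpha_gt0 i).
  exists k; apply/negP => lt_k; move: lt_alpha => /=.
  by rewrite q_star_above// ltxx.
case: (ex_minnP ex_k) => k nlt_k min_k; exists k; split => j.
  by move=> jk; apply: contraTT jk => /min_k; rewrite -leqNgt.
rewrite leq_eqVlt => /orP[/eqP<-//|kj]; apply: contra nlt_k => lt_j.
exact: slot_lt_trans lt_j (slot_lt_column i kj).
Qed.

Lemma q_star_complementary_slackness :
  let lam := marginal u sigma.1 sigma.2.-1 in
  exists M : 'I_m -> R, forall i j,
    u i j%:R - lam * j%:R <= M i /\
    (M i - (u i j%:R - lam * j%:R)) * (qs (i, j) - qs (i, j.+1)) = 0.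
Proof.
move=> lam; pose w i j : R := u i j%:R - lam * j%:R.
have wS i j : w i j.+1 - w i j = marginal u i j - lam.
  by rewrite /w /marginal -[in lam * _]natr1; ring.
suff /choice[M HM] i : exists M, forall j,
    w i j <= M /\ (M - w i j) * (qs (i, j) - qs (i, j.+1)) = 0.
  by exists M.
have [k [above below]] := level i; exists (w i k) => j; split.
  (* Increments of [w i] are nonnegative before [k] and nonpositive from [k] on; induct on the
     distance to [k] on each side. *)
  have [jk|/ltnW kj] := leqP j k.
    rewrite -(subKn jk); elim: (k - j)%N (leq_subr j k) => [|d IHd] dk.
      by rewrite subn0.
    apply: le_trans (IHd (ltnW dk)); rewrite -subr_ge0.
    rewrite -(subnSK dk) wS subr_ge0.
    by apply: (slot_lt_marginal (above _ _)); rewrite ltn_subrL /= (leq_trans _ dk).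
  rewrite -(subnKC kj); elim: (j - k)%N => [|d IHd]; first by rewrite addn0.
  apply: le_trans IHd; rewrite addnS -subr_le0 wS subr_le0.
  by apply: (slot_nlt_marginal (below _ _)); rewrite leq_addr.
have [jk|kj|->] := ltngtP j k; last by rewrite subrr mul0r.
  (* For [j < k] both values are [alpha i], including at [j = 0]. *)
  have qj1 := q_star_above (above _ jk).
  suff -> : qs (i, j) = qs (i, j.+1) by rewrite subrr mulr0.
  by apply/le_anti; rewrite q_star_noninc qj1 q_star_le_alpha.
case: j kj => // j; rewrite ltnS => kj.
(* If this slot is [sigma], it is the first one not above [sigma], so [j = k]; the increment of
   [w i] there is the marginal of [sigma] minus [lam], which is 0, and the maximum is also attained
   at [k.+1]. Otherwise the slot and its successor are empty. *)
have [eq_sigma|ne_sigma] := eqVneq (i, j.+1) sigma.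
  suff jk : j = k.
    have := wS i k; rewrite /lam -eq_sigma /= jk subrr => /eqP.
    by rewrite subr_eq0 => /eqP->; rewrite subrr mul0r.
  apply/eqP; rewrite eqn_leq kj andbT leqNgt; apply: contraL (below k (leqnn k)).
  by move=> /(slot_lt_column i); rewrite eq_sigma negbK.
have qj : qs (i, j.+1) = 0.
  by rewrite q_starE (negPf ne_sigma) (negPf (below _ kj)).
suff -> : qs (i, j.+2) = 0 by rewrite qj subrr mulr0.
by apply/le_anti; rewrite q_star_ge0 -[X in _ <= X]qj q_star_noninc.
Qed.

End Threshold.

(** * Optimality by comparing Lagrangian forms *)

Theorem proposition1 (R : realType) (m : nat) (rho : R)
    (u : 'I_m -> R -> R) (alpha : 'I_m -> R) (sigma : slot m)
    (hm : (1 <= m)%N)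
    (hrho : 0 < rho)
    (hu : forall i : 'I_m, concave_on_nonneg (u i))
    (alpha_gt0 : forall i : 'I_m, 0 < alpha i)
    (alpha_sum : \sum_(i < m) alpha i = 1)
    (hsigma : is_threshold u alpha rho sigma) :
  is_optimizer u alpha rho (q_star u alpha rho sigma).
Proof.
have qs_feasible := q_star_feasible hu alpha_gt0 hsigma.
split=> // q q_feasible.
have [M HM] := q_star_complementary_slackness hu alpha_gt0 hsigma.
have uM i j := (HM i j).1; have slack i j := (HM i j).2.
rewrite (feasible_utility qs_feasible uM) (feasible_utility q_feasible uM).
(* Slackness cancels the gap of [q_star], while that of [q] can only lower the common constant. *)
rewrite [X in (_ <= _ - X)%E]big1 ?sube0; last first.
  by move=> i _; rewrite eseries0// => j _ _; rewrite slack.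
rewrite geeDl// oppe_le0; apply: sume_ge0 => i _; apply: nneseries_ge0 => j _ _.
rewrite lee_fin mulr_ge0 ?subr_ge0//.
by case: (q_feasible.2 i j).
Qed.
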